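(* Let $(B,\vee,\wedge,\partial,0,1)$ be a finite Boolean algebra with $2^n$ elements, and fix an enumeration $a_1,\dots,a_{2^n}$ of its elements. Then: (i) $B$ has exactly $n$ ideals of cardinality $2^{n-1}$; (ii) for $n\ge 2$, if $I_1,\dots,I_n$ are these ideals, the linear subspace of $\mathbb{Z}_2^{2^n}$ spanned by their codewords $c_{I_1},\dots,c_{I_n}$ is a Hadamard code of type $[2^n,n,2^{n-1}]_2$, i.e. a binary linear code of length $2^n$, dimension $n$ and minimum distance $2^{n-1}$.
   Context: An ideal of a Boolean algebra $B$ is a nonempty subset $I\subseteq B$ such that $x\le i\in I$ implies $x\in I$, and $i,j\in I$ implies $i\vee j\in I$ (equivalently, an ideal of the associated Boolean ring). For a subset $I$ of $B=\{a_1,\dots,a_{2^n}\}$, its codeword is $c_I=(c_1,\dots,c_{2^n})\in\mathbb{Z}_2^{2^n}$ with $c_i=1$ if $a_i\in I$ and $c_i=0$ otherwise. A binary linear code of length $N$ is a subspace of $\mathbb{Z}_2^N$; its distance is the minimum Hamming weight of its nonzero vectors. *)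

(* Defs.v *)
From HB Require Import structures.
From mathcomp Require Import all_boot all_order all_algebra.

Set Implicit Arguments.
Unset Strict Implicit.
Unset Printing Implicit Defensive.

Import Order.TTheory GRing.Theory.

Section Ideals.
Variables (d : Order.disp_t) (B : finCTBDistrLatticeType d).

Definition is_ideal (I : {set B}) : bool :=
  [&& I != set0,
      [forall x : B, forall i : B, (i \in I) && (x <= i)%O ==> (x \in I)]
    & [forall i : B, forall j : B,
        (i \in I) && (j \in I) ==> ((i `|` j)%O \in I)]].

(* The ideals with 2^(n-1) elements. The condition is doubled because the
   truncated predecessor would read 2^(n-1) as 1 for n = 0 (trivial algebra),
   where no ideal has 1/2 element. *)
Definition half_ideals (n : nat) : {set {set B}} :=
  [set I : {set B} | is_ideal I & 2 * #|I| == 2 ^ n].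

Definition codeword (N : nat) (a : 'I_N -> B) (I : {set B}) : 'rV['F_2]_N :=
  (\row_(i < N) (a i \in I)%:R)%R.

End Ideals.

Section Codes.
Variable N : nat.

Definition hamming_weight (v : 'rV['F_2]_N) : nat :=
  #|[set i : 'I_N | v ord0 i != 0%R]|.

Definition has_distance (C : {vspace 'rV['F_2]_N}) (w : nat) : Prop :=
  (exists v, [/\ v \in C, v != 0%R & hamming_weight v = w]) /\
  (forall v, v \in C -> v != 0%R -> w <= hamming_weight v).

(* C is a binary linear [N, k, w] code; the length N is carried by the type. *)
Definition linear_code_type (C : {vspace 'rV['F_2]_N}) (k w : nat) : Prop :=
  \dim C = k /\ has_distance C w.

End Codes.

(* Main.v *)
Require Import Defs.
From HB Require Import structures.
From mathcomp Require Import all_boot all_order all_algebra.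

Set Implicit Arguments.
Unset Strict Implicit.
Unset Printing Implicit Defensive.

Import Order.Theory GRing.Theory.

(** A finite Boolean algebra with 2^n elements is the power set of its n atoms,
    and every ideal is principal; the ideal below m has 2^k elements, where k is
    the number of atoms below m. So the ideals of size 2^(n-1) are those below
    the complement of an atom p, i.e. the sets of elements that do not lie above
    p. For a combination v of their codewords in which the codeword attached to
    p has nonzero coefficient, adding or removing p from an element leaves every
    other codeword unchanged at that element and toggles the one of p; this
    injection exchanges the support of v with its complement, hence v has weight
    2^(n-1). In particular the codewords are linearly independent. *)

(** * Atoms and the representation of elements by sets of atoms *)

Section Atoms.
Variables (d : Order.disp_t) (B : finCTBDistrLatticeType d).
Implicit Types (p q x y m : B) (I S : {set B}).

Definition atoms : {set B} :=
  [set p : B | (p != \bot%O) &&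
     [forall x : B, (x <= p)%O ==> (x == \bot%O) || (x == p)]].

Lemma atomP p :
  reflect (p != \bot%O /\ forall x, (x <= p)%O -> x = \bot%O \/ x = p)
          (p \in atoms).
Proof.
rewrite inE; apply: (iffP andP) => -[p0 minp]; split=> //.
  by move=> x le_xp; move/forallP/(_ x)/implyP/(_ le_xp)/orP: minp
    => -[] /eqP ->; [left | right].
by apply/forallP=> x; apply/implyP=> /minp [] ->; rewrite eqxx ?orbT.
Qed.

Lemma atom_meet_eq0 p x : p \in atoms -> ((p `&` x)%O == \bot%O) = ~~ (p <= x)%O.
Proof.
case/atomP=> p0 minp; rewrite leEmeet.
by case: (minp _ (leIl p x)) => ->; rewrite eqxx ?(negPf p0) // eq_sym p0.
Qed.

Lemma atom_leC p x : p \in atoms -> (p <= ~` x)%O = ~~ (p <= x)%O.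
Proof. by move=> /atom_meet_eq0 <-; rewrite disj_leC. Qed.

Lemma atom_leU p x y :
  p \in atoms -> (p <= x `|` y)%O = (p <= x)%O || (p <= y)%O.
Proof.
move=> pA; apply/idP/idP; last exact: lexU2.
case: (boolP (p <= x)%O) => //=; rewrite -atom_meet_eq0 // => /eqP px0.
by rewrite leEmeet meetUr px0 join0x -leEmeet.
Qed.

Lemma atom_le_atom p q : p \in atoms -> q \in atoms -> (p <= q)%O = (p == q).
Proof.
move=> /atomP[p0 _] /atomP[_ minq]; apply/idP/eqP => [/minq[] // p_bot|-> //].
by rewrite p_bot eqxx in p0.
Qed.

Lemma exists_atom_le x : x != \bot%O -> exists2 p, p \in atoms & (p <= x)%O.
Proof.
move=> x0; pose P := [pred y : B | (y != \bot%O) && (y <= x)%O].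
have Px : P x by rewrite /= x0 lexx.
(* The size of the down-set serves as a rank: a nonzero element below [x] of least rank has no
   nonzero element strictly below it. *)
case: (arg_minnP (fun y => #|[set z : B | (z <= y)%O]|) Px)
  => p /andP[p0 le_px] minp.
exists p => //; apply/atomP; split=> // y le_yp.
case: (eqVneq y \bot%O) => [|y0]; [by left | right].
have /minp le_card : P y by rewrite /= y0 (le_trans le_yp).
have sub : [set z : B | (z <= y)%O] \subset [set z : B | (z <= p)%O].
  by apply/subsetP=> z; rewrite !inE => /le_trans; apply.
have /eqP/setP/(_ p) : [set z : B | (z <= y)%O] == [set z : B | (z <= p)%O].
  by rewrite eqEcard sub.
by rewrite !inE lexx => le_py; apply/le_anti; rewrite le_yp le_py.
Qed.

(** The Stone representation map into the power set of the atoms. *)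
Definition shadow x : {set B} := [set p in atoms | (p <= x)%O].

Lemma in_shadow p x : (p \in shadow x) = (p \in atoms) && (p <= x)%O.
Proof. by rewrite in_set. Qed.

Lemma shadow_sub_atoms x : shadow x \subset atoms.
Proof. by apply/subsetP=> p; rewrite in_shadow => /andP[]. Qed.

Lemma shadow_subset x y : (shadow x \subset shadow y) = (x <= y)%O.
Proof.
apply/subsetP/idP => [sub | le_xy p]; last first.
  by rewrite !in_shadow => /andP[-> /le_trans]; apply.
(* If [x] is not below [y], then [x] minus [y] is nonzero, and an atom below it separates the two
   shadows. *)
apply/contraT; rewrite -diff_eq0 => /exists_atom_le [p pA].
rewrite diffE lexI atom_leC // => /andP[le_px].
by have /sub : p \in shadow x by [rewrite in_shadow pA]; rewrite in_shadow pA => /= ->.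
Qed.

Lemma shadow_inj : injective shadow.
Proof.
move=> x y eq_xy; apply/le_anti.
by rewrite -!shadow_subset eq_xy subxx.
Qed.

Lemma shadow_join S : S \subset atoms -> shadow (\join_(p in S) p)%O = S.
Proof.
move=> sSA; apply/setP=> q; rewrite in_shadow; case: (boolP (q \in atoms)) => qA /=.
  apply/idP/idP => [|qS]; last exact: (joins_sup (fun p => p)).
  (* Distinct atoms are disjoint, so an atom [q] outside [S] has every member of [S], hence their
     join, below its complement. *)
  apply: contraTT => qS; rewrite -atom_leC // lexC.
  apply/joinsP=> p pS; have pA := subsetP sSA p pS.
  by rewrite atom_leC // atom_le_atom //; apply: contraNneq qS => <-.
by apply/esym/negbTE; apply: contraNN qA => /(subsetP sSA).
Qed.

(** [shadow] maps the down-set of [m] bijectively onto the subsets of [shadow m]; joins of atoms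
    provide the preimages. *)
Lemma card_down m : #|[set x : B | (x <= m)%O]| = 2 ^ #|shadow m|.
Proof.
rewrite -card_powerset -(card_imset _ shadow_inj).
apply: eq_card => S; rewrite powersetE; apply/imsetP/idP.
  by case=> x; rewrite inE -shadow_subset => sub ->.
move=> sub; exists (\join_(p in S) p)%O; last first.
  by rewrite shadow_join // (subset_trans sub) // shadow_sub_atoms.
rewrite inE; apply/joinsP => p /(subsetP sub).
by rewrite in_shadow => /andP[].
Qed.

Lemma card_atoms n : #|B| = 2 ^ n -> #|atoms| = n.
Proof.
move=> cardB; apply/eqP; rewrite -(eqn_exp2l _ _ (ltnSn 1)) -cardB -cardsT.
have <- : shadow \top%O = atoms.
  by apply/setP=> p; rewrite in_shadow lex1 andbT.
by rewrite -card_down; apply/eqP/eq_card => x; rewrite !inE lex1.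
Qed.

(** * Ideals and those of half size *)

Lemma ideal_principal I : is_ideal I -> exists m, I = [set x : B | (x <= m)%O].
Proof.
case/and3P=> /set0Pn[i iI] /forallP down /forallP join.
have dn x j : j \in I -> (x <= j)%O -> x \in I.
  by move=> jI le_xj; move/forallP/(_ j)/implyP: (down x); apply; rewrite jI.
(* By finiteness the join of all members of [I] is again in [I]; nonemptiness supplies the bottom
   element that starts the induction. *)
exists (\join_(j in I) j)%O; apply/setP=> x; rewrite inE; apply/idP/idP => [xI|].
  exact: (joins_sup (fun j => j)).
apply: (dn); elim/big_ind: _ => //; first exact: dn iI (le0x i).
move=> j k jI kI; move/forallP/(_ k)/implyP: (join j); apply.
by rewrite jI.
Qed.

Lemma down_is_ideal m : is_ideal [set x : B | (x <= m)%O].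
Proof.
apply/and3P; split.
- by apply/set0Pn; exists \bot%O; rewrite inE le0x.
- apply/forallP=> x; apply/forallP=> i; apply/implyP; rewrite !inE.
  by case/andP=> le_im /le_trans; apply.
- apply/forallP=> i; apply/forallP=> j; apply/implyP; rewrite !inE.
  by rewrite leUx.
Qed.

Definition not_above p : {set B} := [set x : B | ~~ (p <= x)%O].

Lemma not_aboveE p : p \in atoms -> not_above p = [set x : B | (x <= ~` p)%O].
Proof. by move=> pA; apply/setP=> x; rewrite !inE lexC atom_leC. Qed.

Lemma not_above_inj : injective not_above.
Proof.
move=> p q /setP eq_pq; apply/le_anti.
(* Neither element belongs to its own set, so testing the equality at [q] and at [p] gives both
   inequalities. *)
move: (eq_pq q) (eq_pq p); rewrite !inE !lexx /=.
by move=> /negbFE -> /esym/negbFE ->.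
Qed.

Lemma shadowC p : shadow (~` p)%O = atoms :\: shadow p.
Proof.
apply/setP=> q; rewrite in_setD !in_shadow; case: (boolP (q \in atoms)) => //= qA.
by rewrite andbT; apply: atom_leC.
Qed.

Lemma shadow_atom p : p \in atoms -> shadow p = [set p].
Proof.
move=> pA; apply/setP=> q; rewrite in_shadow in_set1; case: (boolP (q \in atoms)) => qA /=.
  exact: atom_le_atom.
by apply/esym/negbTE; apply: contraNneq qA => ->.
Qed.

Lemma half_idealsE n : #|B| = 2 ^ n -> half_ideals B n = not_above @: atoms.
Proof.
move=> cardB; have cardA := card_atoms cardB.
apply/setP=> I; rewrite inE; apply/andP/imsetP.
  case=> /ideal_principal[m ->].
  rewrite card_down -expnS eqn_exp2l // => /eqP cardm.
  (* Exactly [n - 1] of the [n] atoms lie below [m]; the missing one is the whole shadow of the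
     complement, hence equal to it. *)
  have /cards1P[p defp] : #|shadow (~` m)%O| == 1.
    by rewrite shadowC cardsD (setIidPr (shadow_sub_atoms m)) cardA -cardm subSnn.
  have pA : p \in atoms.
    by apply: (subsetP (shadow_sub_atoms (~` m)%O)); rewrite defp set11.
  exists p => //; rewrite not_aboveE //.
  have -> : p = (~` m)%O by apply: shadow_inj; rewrite shadow_atom.
  by rewrite complK.
case=> p pA ->; rewrite not_aboveE // down_is_ideal; split=> //.
rewrite card_down -expnS shadowC shadow_atom // cardsD.
have /setIidPr -> : [set p] \subset atoms by rewrite sub1set.
(* The atom [p] itself witnesses [0 < n], so the truncated predecessor is harmless. *)
by rewrite cards1 cardA subn1 prednK // -cardA card_gt0; apply/set0Pn; exists p.
Qed.

(** For an atom [p], this is the symmetric difference with [p]: on shadows it flips membership of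
    [p] alone. *)
Definition toggle p x : B := if (p <= x)%O then (x `\` p)%O else (x `|` p)%O.

Lemma le_toggle p q x : p \in atoms -> q \in atoms ->
  (q <= toggle p x)%O = (q == p) (+) (q <= x)%O.
Proof.
move=> pA qA; rewrite /toggle; case: ifPn => le_px.
  rewrite diffE lexI atom_leC // (atom_le_atom qA pA).
  by case: eqVneq => [->|_]; rewrite ?le_px ?andbT ?andbF.
rewrite atom_leU // (atom_le_atom qA pA) orbC.
by case: eqVneq => [->|_] //=; rewrite le_px.
Qed.

Lemma toggleK p : p \in atoms -> involutive (toggle p).
Proof.
move=> pA x; apply: shadow_inj; apply/setP=> q; rewrite !in_shadow.
by case: (boolP (q \in atoms)) => //= qA; rewrite !le_toggle // addbA addbb.
Qed.

End Atoms.

(** * Weights of combinations of codewords *)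

Lemma card_half_of_involution (T : finType) (f : T -> T) (P : pred T) :
  involutive f -> (forall x, P (f x) = ~~ P x) -> 2 * #|P| = #|T|.
Proof.
move=> fK fP; rewrite -(cardC P) mul2n -addnn; congr (_ + _).
rewrite -(card_image (inv_inj fK) P); apply: eq_card => y.
rewrite inE; apply/imageP/idP => [[x Px ->]|nPy].
  by rewrite -topredE /= fP negbK.
by exists (f y); rewrite ?fK // -topredE /= fP.
Qed.

Lemma F2_neq0 (x : 'F_2) : (x != 0%R) = (x == 1%R).
Proof. by case: x => -[|[|]]. Qed.

Lemma weight_codeword_comb (d : Order.disp_t) (B : finCTBDistrLatticeType d)
    (N n : nat) (a : 'I_N -> B) (p : 'I_n -> B) (c : 'I_n -> 'F_2) (k : 'I_n) :
  bijective a -> injective p -> (forall j, p j \in atoms B) -> c k != 0%R ->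
  2 * hamming_weight (\sum_j c j *: codeword a (not_above (p j)))%R = N.
Proof.
move=> [b aK bK] p_inj pA ck0; rewrite /hamming_weight.
set v := (\sum_j _)%R; pose f i := b (toggle (p k) (a i)).
have fK : involutive f by move=> i; rewrite /f bK toggleK // aK.
have vE i : (v ord0 i = \sum_j c j * (~~ (p j <= a i)%O)%:R)%R.
  by rewrite summxE; apply: eq_bigr => j _; rewrite !mxE inE.
have vf i : v ord0 (f i) = (v ord0 i + 1)%R.
  (* Toggling [p k] flips only the [k]-th term, whose coefficient is 1 in ['F_2]; flipping a bit is
     adding 1. *)
  rewrite !vE (bigD1 k) // [in RHS](bigD1 k) //= /f bK le_toggle // eqxx.
  have -> : c k = 1%R by apply/eqP; rewrite -F2_neq0.
  rewrite [in RHS]addrAC; congr (_ + _)%R.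
    by case: (_ <= _)%O; apply/val_inj.
  apply: eq_bigr => j j_neq_k.
  by rewrite le_toggle // (inj_eq p_inj) (negPf j_neq_k).
rewrite cardsE -[RHS]card_ord; apply: (card_half_of_involution fK) => i.
rewrite /= vf.
by rewrite F2_neq0 negbK -subr_eq0 addrK.
Qed.

Theorem theorem2 (d : Order.disp_t) (B : finCTBDistrLatticeType d) (n : nat)
  (cardB : #|B| = 2 ^ n) (a : 'I_(2 ^ n) -> B) (a_bij : bijective a) :
  #|half_ideals B n| = n /\
  (2 <= n ->
   forall I_ : 'I_n -> {set B},
     injective I_ ->
     (forall J : {set B}, J \in half_ideals B n <-> exists k, I_ k = J) ->
     linear_code_type <<[seq codeword a (I_ k) | k : 'I_n]>>%VS n (2 ^ (n - 1))).
Proof.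
have halfE := half_idealsE cardB; split.
  by rewrite halfE (card_imset _ (@not_above_inj _ _)) (card_atoms cardB).
move=> n_ge2 I_ I_inj I_half; have n_gt0 := ltnW n_ge2.
have /fin_all_exists[p pP] k : exists q, q \in atoms B /\ I_ k = not_above q.
  have /imsetP[q qA ->] : I_ k \in not_above (B:=B) @: atoms B.
    by rewrite -halfE; apply/I_half; exists k.
  by exists q.
have p_inj : injective p.
  by move=> i j eq_ij; apply: I_inj; rewrite !(proj2 (pP _)) eq_ij.
pose X := mktuple (fun k => codeword a (I_ k)).
rewrite -[image_mem _ _]/(val X).
have nthX (k : 'I_n) : (X`_k)%R = codeword a (not_above (p k)).
  by rewrite -tnth_nth tnth_mktuple (proj2 (pP k)).
have weightX (c : 'I_n -> 'F_2) k : c k != 0%R ->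
    hamming_weight (\sum_j c j *: X`_j)%R = 2 ^ (n - 1).
  move=> ck0; apply/eqP; rewrite -(@eqn_pmul2l 2) // -expnS subn1 prednK //.
  under eq_bigr do rewrite nthX.
  by rewrite (weight_codeword_comb a_bij p_inj (fun j => proj1 (pP j)) ck0).
have weight0 : hamming_weight (0%R : 'rV['F_2]_(2 ^ n)) = 0.
  by apply/eqP; rewrite cards_eq0; apply/eqP/setP=> i; rewrite !inE mxE eqxx.
have freeX : free X.
  (* A nonzero coefficient would give the zero vector weight [2 ^ (n - 1)], which is positive. *)
  apply/freeP=> c sum0 k; apply/eqP/negPn/negP => /weightX.
  by rewrite sum0 weight0 => /esym/eqP; rewrite expn_eq0.
split; first by move/eqP: freeX; rewrite size_tuple.
split; last first.
  move=> v /coord_span -> nz.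
  case: (pickP (fun k => coord X k v != 0%R)) => [k ck0|c0].
    by rewrite (weightX (fun j => coord X j v) k ck0).
  case/eqP: nz; apply: big1 => j _.
  by move/negbFE/eqP: (c0 j) => ->; rewrite scale0r.
pose k := Ordinal n_gt0.
have Xk : hamming_weight (X`_k)%R = 2 ^ (n - 1).
  (* Kronecker coefficients present a single codeword as a combination. *)
  rewrite -(weightX (fun j => (j == k)%:R%R) k) ?eqxx //.
  rewrite (bigD1 k) // eqxx scale1r big1 /= ?addr0 // => j /negPf ->.
  by rewrite scale0r.
exists (X`_k)%R; split=> //; first by rewrite memv_span // mem_nth ?size_tuple.
by apply: contra_eq_neq Xk => ->; rewrite weight0 eq_sym expn_eq0.
Qed.
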